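(* For every $\epsilon>0$ there exists a constant $c_\epsilon>0$, depending only on $\epsilon$, such that for every real number $q>1$, $$\#T_3([0,q]^3\cap \mathbb{Z}^3)\ \ge\ c_\epsilon\, q^{9-\epsilon},$$ where $T_3([0,q]^3\cap \mathbb{Z}^3)$ denotes the collection of all congruence classes of (non-degenerate) tetrahedra with vertices in $[0,q]^3\cap\mathbb{Z}^3$.
   Context: A (non-degenerate) tetrahedron with vertices in $[0,q]^3\cap\mathbb{Z}^3$ is given by four points of $[0,q]^3\cap\mathbb{Z}^3$ that are affinely independent in $\mathbb{R}^3$; when one of the vertices is the origin and the others are $\mathbf{x},\mathbf{y},\mathbf{z}$, this means that $\mathbf{x},\mathbf{y},\mathbf{z}$ are linearly independent. Two tetrahedra are congruent if some isometry of Euclidean space $\mathbb{R}^3$ (orientation-reversing isometries allowed) maps the vertex set of one onto the vertex set of the other; equivalently, their vertices can be matched so that all corresponding pairwise distances are equal. $T_3([0,q]^3\cap \mathbb{Z}^3)$ is the set of equivalence classes under this relation of tetrahedra with all vertices in $[0,q]^3\cap\mathbb{Z}^3$, and $\#$ denotes cardinality. *)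

(* Defs.v *)
From HB Require Import structures.
From mathcomp Require Import all_boot all_order all_algebra.
From mathcomp Require Import finmap.
From mathcomp Require Import all_classical all_reals all_analysis.

Set Implicit Arguments.
Unset Strict Implicit.
Unset Printing Implicit Defensive.

Import Order.TTheory GRing.Theory Num.Theory.

Local Open Scope classical_set_scope.
Local Open Scope ring_scope.

(* The library norm on 'rV[R]_d is the sup norm, hence this explicit
   Euclidean distance. *)
Definition edist (R : realType) (d : nat) (x y : 'rV[R]_d) : R :=
  Num.sqrt (\sum_(i < d) (x 0 i - y 0 i) ^+ 2).

(* Such a map of R^d to itself is automatically bijective, and it may reverse
   the orientation. *)
Definition isometry (R : realType) (d : nat) (f : 'rV[R]_d -> 'rV[R]_d) : Prop :=
  forall x y, edist (f x) (f y) = edist x y.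

Definition affinely_independent (R : realType) (d n : nat)
    (v : 'I_n.+1 -> 'rV[R]_d) : bool :=
  free [seq v (lift ord0 i) - v ord0 | i : 'I_n].

Definition lattice_cube (R : realType) (q : R) : set 'rV[R]_3 :=
  [set x : 'rV[R]_3 | forall i, [/\ x 0 i \is a Num.int, 0 <= x 0 i & x 0 i <= q]].

(* A tetrahedron is identified with its set of four vertices. *)
Definition tetrahedra (R : realType) (q : R) : set (set 'rV[R]_3) :=
  [set S | exists v : 'I_4 -> 'rV[R]_3,
     [/\ S = range v, affinely_independent v & S `<=` lattice_cube q]].

Definition congruent (R : realType) (d : nat) (S S' : set 'rV[R]_d) : Prop :=
  exists2 f, isometry f & f @` S = S'.

Definition congruence_class (R : realType) (q : R) (S : set 'rV[R]_3) :
    set (set 'rV[R]_3) :=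
  [set S' | tetrahedra q S' /\ congruent S S'].

(* T3 q is finite, as lattice_cube q is; fset_set, which is empty on infinite
   sets, therefore gives its actual cardinality. *)
Definition T3 (R : realType) (q : R) : set (set (set 'rV[R]_3)) :=
  [set congruence_class q S | S in tetrahedra q].

(* Main.v *)
Require Import Defs.
From HB Require Import structures.
From mathcomp Require Import all_boot all_order all_algebra.
From mathcomp Require Import finmap.
From mathcomp Require Import all_classical all_reals all_analysis.
From mathcomp Require Import ring lra zify.

(** The bound holds because a typical lattice tetrahedron is congruent to only
    boundedly many others.  Put one vertex at the origin and write the other
    three as the rows of an integer matrix [X].  There are about [q ^ 9] such
    matrices, and by Cauchy-Schwarz ([sqr_card_le_fiber_pairs]) it is enough to
    see that only [O(q ^ 9)] ordered pairs of them are congruent.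

    A congruence, after translation, turns the rows of [X] into the rows of an
    integer matrix [Y] with [Y *m Y^T = X *m X^T]; so [Y = X *m M] for a
    rational orthogonal [M].  Up to sign [M] is a rotation, and Euler-Rodrigues
    writes it as [qrot a b c d] divided by [n = qnorm a b c d], for integers
    [a, b, c, d] without common divisor ([isometric_quaternion]).  Given [M], the
    rows of [X] lie in the sublattice of the integer vectors that [M] maps to
    integer vectors.

    This sublattice has index at least [n / 4]: the entries of [qrot a b c d]
    and [n] have a common divisor at most 4 ([primitive_qrot_gcd]), and then a
    suitable integer vector has order at least [n / 4] modulo the sublattice
    ([exists_large_order]).  Since the sublattice contains three independent
    vectors of the box [0, Q] ^ 3, where [Q] is the integer part of [q], it has
    [O(Q ^ 3 / n)] points in the box: translates by these points of a system of
    representatives, chosen in the parallelepiped of the three vectors, are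
    disjoint and stay in a box of side [4 * Q] ([card_sublattice_box]).  Hence
    [M] accounts for [O((Q ^ 3 / n) ^ 3)] pairs.

    Finally the sum of [n ^ -3] over nonzero integer quadruples converges, the
    exponent 6 of the Euclidean norm being larger than the dimension 4
    ([sum_inv_norm_cube]).  So there are [O(Q ^ 9)] congruent pairs
    ([card_isometric_pairs]) and at least a constant times [q ^ 9] classes
    ([T3_lower_bound]), which for [q > 1] dominates [q ^ (9 - eps)]. *)

Set Implicit Arguments.
Unset Strict Implicit.
Unset Printing Implicit Defensive.
Import Order.TTheory GRing.Theory Num.Theory.

Local Open Scope ring_scope.

(** * Classes and congruent pairs *)

(** Cauchy-Schwarz for the sizes of the fibres of [c]: many elements with few
    coincidences force many values. *)
Lemma sqr_card_le_fiber_pairs (T C : finType) (c : T -> C) :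
  (#|T| ^ 2 <= #|C| * #|[pred p : T * T | c p.1 == c p.2]|)%N.
Proof.
pose n k := #|[pred t | c t == k]|.
have sumn : (\sum_(k : C) n k = #|T|)%N.
  rewrite -sum1_card (partition_big c xpredT) //=.
  by apply: eq_bigr => k _; rewrite sum1_card.
have sumn2 : (\sum_(k : C) n k ^ 2 = #|[pred p : T * T | c p.1 == c p.2]|)%N.
  rewrite -[RHS]sum1_card (partition_big (fun p => c p.1) xpredT) //=.
  apply: eq_bigr => k _; rewrite sum1_card expnS expn1 -cardX.
  apply: eq_card => -[s t]; rewrite !inE /=.
  rewrite [in RHS]unfold_in /= inE /=.
  by apply/andP/andP => [[/eqP -> /eqP ->]|[/eqP <- /eqP ->]].
suff H : (2 * (#|T| ^ 2) <= 2 * (#|C| * \sum_(k : C) n k ^ 2))%N.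
  by rewrite -sumn2; lia.
(* Twice the inequality is the sum of [2 * n k * n l <= n k ^ 2 + n l ^ 2] over
   all pairs of values. *)
have -> : (2 * (#|C| * \sum_(k : C) n k ^ 2) =
  \sum_(k : C) \sum_(l : C) (n k ^ 2 + n l ^ 2))%N.
  under [RHS]eq_bigr do rewrite big_split /= sum_nat_const.
  rewrite big_split /= sum_nat_const -big_distrr /=.
  by rewrite addnn -mul2n; congr (_ * (_ * _))%N; exact: eq_card.
rewrite -sumn expnS expn1 big_distrl big_distrr /= leq_sum // => k _.
rewrite big_distrr big_distrr /= leq_sum // => l _.
exact: nat_Cauchy.
Qed.

(** * Three-by-three matrices *)

(** Named indices keep matrix entries as atoms for [ring] and [lra]; the numerals
    of the ring ['I_3] would unfold to arithmetic modulo 3. *)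
Definition e0 : 'I_3 := @Ordinal 3 0 isT.
Definition e1 : 'I_3 := @Ordinal 3 1 isT.
Definition e2 : 'I_3 := @Ordinal 3 2 isT.

Lemma sum_ord3 (V : nmodType) (F : 'I_3 -> V) :
  \sum_i F i = F e0 + F e1 + F e2.
Proof.
rewrite !big_ord_recl big_ord0 addr0 addrA.
by congr (F _ + F _ + F _); apply: val_inj.
Qed.

Lemma forall_ord3 (P : 'I_3 -> Prop) : P e0 -> P e1 -> P e2 -> forall i, P i.
Proof.
move=> P0 P1 P2 [[|[|[|//]]] lti]; [move: P0|move: P1|move: P2];
  by congr P; apply: val_inj.
Qed.

Lemma det_mx2 (R : comNzRingType) (N : 'M[R]_2) :
  \det N = N ord0 ord0 * N ord_max ord_max - N ord0 ord_max * N ord_max ord0.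
Proof.
rewrite (expand_det_row _ ord0) !big_ord_recl big_ord0 /cofactor !det_mx11 !mxE /=.
rewrite expr0 mul1r expr1 mulN1r mulrN addr0.
by congr (_ * N _ _ - N _ _ * N _ _); apply: val_inj.
Qed.

Lemma det_mx3 (R : comNzRingType) (M : 'M[R]_3) :
  \det M = M e0 e0 * (M e1 e1 * M e2 e2 - M e1 e2 * M e2 e1)
         - M e0 e1 * (M e1 e0 * M e2 e2 - M e1 e2 * M e2 e0)
         + M e0 e2 * (M e1 e0 * M e2 e1 - M e1 e1 * M e2 e0).
Proof.
rewrite (expand_det_row _ e0) sum_ord3 /cofactor !det_mx2 !mxE /=.
rewrite expr0 mul1r expr1 mulN1r mulrN -signr_odd /= expr0 mul1r.
by congr (_ * (M _ _ * M _ _ - M _ _ * M _ _) - _ * (M _ _ * M _ _ - M _ _ * M _ _)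
  + _ * (M _ _ * M _ _ - M _ _ * M _ _)); apply: val_inj.
Qed.

(** * Rational rotations and integer quaternions *)
Definition qnorm (R : pzRingType) (a b c d : R) : R :=
  a ^+ 2 + b ^+ 2 + c ^+ 2 + d ^+ 2.

(** The Euler-Rodrigues matrix of the quaternion [a + b i + c j + d k]: the map
    [x |-> q x q^*] on imaginary quaternions, that is [qnorm a b c d] times a
    rotation. *)
Definition qrot (R : pzRingType) (a b c d : R) : 'M[R]_3 := \matrix_(i, j)
  nth 0 (nth [::] [::
    [:: a ^+ 2 + b ^+ 2 - c ^+ 2 - d ^+ 2;
        2 * (b * c - a * d); 2 * (b * d + a * c)];
    [:: 2 * (b * c + a * d);
        a ^+ 2 - b ^+ 2 + c ^+ 2 - d ^+ 2; 2 * (c * d - a * b)];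
    [:: 2 * (b * d - a * c); 2 * (c * d + a * b);
        a ^+ 2 - b ^+ 2 - c ^+ 2 + d ^+ 2]] i) j.

Lemma qrotZ (R : comPzRingType) (t a b c d : R) :
  qrot (t * a) (t * b) (t * c) (t * d) = t ^+ 2 *: qrot a b c d.
Proof.
apply/matrixP; apply: forall_ord3; apply: forall_ord3; rewrite !mxE /=; ring.
Qed.

(** The transpose of a rotation is both its inverse and its adjugate.  Only one
    entry is treated; the others follow by cyclic permutation of the indices. *)
Lemma rotation_cofactor (R : comNzRingType) (m11 m12 m13 m21 m22 m23 m31 m32 m33 : R) :
  m11 * m11 + m21 * m21 + m31 * m31 = 1 ->
  m11 * m12 + m21 * m22 + m31 * m32 = 0 ->
  m11 * m13 + m21 * m23 + m31 * m33 = 0 ->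
  m11 * (m22 * m33 - m23 * m32) - m12 * (m21 * m33 - m23 * m31)
    + m13 * (m21 * m32 - m22 * m31) = 1 ->
  m11 = m22 * m33 - m23 * m32.
Proof.
move=> h1 h2 h3 hd; rewrite -[LHS]mulr1 -hd -[RHS]mulr1 -h1.
rewrite -[RHS]addr0 -[X in _ = _ + X](mulr0 (m23 * m31 - m21 * m33)) -{1}h2.
rewrite -[RHS]addr0 -[X in _ = _ + X](mulr0 (m21 * m32 - m22 * m31)) -h3.
ring.
Qed.

(** If [M] is the rotation of a quaternion [q] of norm [n], then the symmetric
    matrix [4 / n * q^T q] is affine in the entries of [M]; its diagonal
    is [1 + m11 + m22 + m33], [1 + m11 - m22 - m33], ..., of sum 4.  So a row of
    this matrix with nonzero diagonal entry recovers [q] up to scaling.  That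
    such a row works is a linear combination of the quadratic relations between
    the entries of [M], which [lra] finds. *)
Lemma rotation_quaternion (M : 'M[rat]_3) :
  M *m M^T = 1%:M -> \det M = 1 ->
  exists a b c d, qnorm a b c d != 0 /\ qrot a b c d = qnorm a b c d *: M.
Proof.
move=> MMt; rewrite det_mx3.
have rows i j : \sum_k M i k * M j k = (i == j)%:R.
  transitivity ((M *m M^T) i j); last by rewrite MMt mxE.
  by rewrite mxE; apply: eq_bigr => k _; rewrite mxE.
have cols i j : \sum_k M k i * M k j = (i == j)%:R.
  transitivity ((M^T *m M) i j); last by rewrite (mulmx1C MMt) mxE.
  by rewrite mxE; apply: eq_bigr => k _; rewrite mxE.
have var x : {y : rat | y = x} by exists x.
have [[[m11 E11] [m12 E12]] [m13 E13]] := (var (M e0 e0), var (M e0 e1), var (M e0 e2)).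
have [[[m21 E21] [m22 E22]] [m23 E23]] := (var (M e1 e0), var (M e1 e1), var (M e1 e2)).
have [[[m31 E31] [m32 E32]] [m33 E33]] := (var (M e2 e0), var (M e2 e1), var (M e2 e2)).
pose E := (E11, E12, E13, (E21, E22, E23), (E31, E32, E33)).
rewrite -!E => hd.
move: (rows e0 e0) (rows e1 e1) (rows e2 e2) (rows e0 e1) (rows e0 e2) (rows e1 e2).
move: (cols e0 e0) (cols e1 e1) (cols e2 e2) (cols e0 e1) (cols e0 e2) (cols e1 e2).
rewrite !sum_ord3 -!E /= => c1 c2 c3 c12 c13 c23 r1 r2 r3 r12 r13 r23.
have k11 : m11 = m22 * m33 - m23 * m32
  by apply: (@rotation_cofactor rat m11 m12 m13 m21 m22 m23 m31 m32 m33); lra.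
have k12 : m12 = m23 * m31 - m21 * m33
  by apply: (@rotation_cofactor rat m12 m13 m11 m22 m23 m21 m32 m33 m31); lra.
have k13 : m13 = m21 * m32 - m22 * m31
  by apply: (@rotation_cofactor rat m13 m11 m12 m23 m21 m22 m33 m31 m32); lra.
have k21 : m21 = m32 * m13 - m33 * m12
  by apply: (@rotation_cofactor rat m21 m22 m23 m31 m32 m33 m11 m12 m13); lra.
have k22 : m22 = m33 * m11 - m31 * m13
  by apply: (@rotation_cofactor rat m22 m23 m21 m32 m33 m31 m12 m13 m11); lra.
have k23 : m23 = m31 * m12 - m32 * m11
  by apply: (@rotation_cofactor rat m23 m21 m22 m33 m31 m32 m13 m11 m12); lra.
have k31 : m31 = m12 * m23 - m13 * m22
  by apply: (@rotation_cofactor rat m31 m32 m33 m11 m12 m13 m21 m22 m23); lra.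
have k32 : m32 = m13 * m21 - m11 * m23
  by apply: (@rotation_cofactor rat m32 m33 m31 m12 m13 m11 m22 m23 m21); lra.
have k33 : m33 = m11 * m22 - m12 * m21
  by apply: (@rotation_cofactor rat m33 m31 m32 m13 m11 m12 m23 m21 m22); lra.
(* [k] is the diagonal entry of the row [(a, b, c, d)] of the symmetric matrix:
   since the matrix has rank 1 and trace 4, the norm of this row is [4 * k]. *)
have pivot k a b c d : k != 0 -> qnorm a b c d = 4 * k ->
    [/\ a ^+ 2 + b ^+ 2 - c ^+ 2 - d ^+ 2 = 4 * k * m11,
        2 * (b * c - a * d) = 4 * k * m12 & 2 * (b * d + a * c) = 4 * k * m13] ->
    [/\ 2 * (b * c + a * d) = 4 * k * m21,
        a ^+ 2 - b ^+ 2 + c ^+ 2 - d ^+ 2 = 4 * k * m22 &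
        2 * (c * d - a * b) = 4 * k * m23] ->
    [/\ 2 * (b * d - a * c) = 4 * k * m31, 2 * (c * d + a * b) = 4 * k * m32 &
        a ^+ 2 - b ^+ 2 - c ^+ 2 + d ^+ 2 = 4 * k * m33] ->
    exists a b c d, qnorm a b c d != 0 /\ qrot a b c d = qnorm a b c d *: M.
  move=> k0 qk [? ? ?] [? ? ?] [? ? ?]; exists a, b, c, d; rewrite qk.
  split; first exact: mulf_neq0.
  by apply/matrixP; do 2 apply: forall_ord3; rewrite !mxE -E.
clear E E11 E12 E13 E21 E22 E23 E31 E32 E33 rows cols var hd MMt.
rewrite /qnorm in pivot *.
have [z0|n0] := eqVneq (1 + m11 + m22 + m33) 0; last first.
  apply: (pivot _ (1 + m11 + m22 + m33) (m32 - m23) (m13 - m31) (m21 - m12) n0);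
    clear pivot n0; do ?split; lra.
have [z1|n1] := eqVneq (1 + m11 - m22 - m33) 0; last first.
  apply: (pivot _ (m32 - m23) (1 + m11 - m22 - m33) (m12 + m21) (m13 + m31) n1);
    clear pivot n1 z0; do ?split; lra.
have [z2|n2] := eqVneq (1 - m11 + m22 - m33) 0; last first.
  apply: (pivot _ (m13 - m31) (m12 + m21) (1 - m11 + m22 - m33) (m23 + m32) n2);
    clear pivot n2 z0 z1; do ?split; lra.
have n3 : 1 - m11 - m22 + m33 != 0 by apply/eqP; lra.
apply: (pivot _ (m21 - m12) (m13 + m31) (m23 + m32) (1 - m11 - m22 + m33) n3);
  clear pivot n3 z0 z1 z2; do ?split; lra.
Qed.

(** Coprimality in Bezout form, which is how [primitive_qrot_gcd] uses it. *)
Definition primitive4 (a b c d : int) : Prop :=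
  exists u v w x : int, u * a + v * b + w * c + x * d = 1.

Lemma rat_quadruple_primitive (a b c d : rat) :
  [|| a != 0, b != 0, c != 0 | d != 0] ->
  exists t : rat, t != 0 /\ exists a' b' c' d' : int,
   primitive4 a' b' c' d' /\
   [/\ a = t * a'%:~R, b = t * b'%:~R, c = t * c'%:~R & d = t * d'%:~R].
Proof.
move=> nz.
have clear_denominator (x : rat) (m : rat) (k : int):
   m = (denq x * k)%:~R -> exists y : int, m * x = y%:~R.
  move=> ->; exists (numq x * k); rewrite !rmorphM /= -[X in _ * X]divq_num_den.
  by have := denq_neq0 x; rewrite -(intr_eq0 rat) => dx; field.
pose m : rat := (denq a * denq b * denq c * denq d)%:~R.
have m0 : m != 0 by rewrite intr_eq0 !mulf_neq0 ?denq_neq0.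
have [A hA] : exists y : int, m * a = y%:~R.
  by apply: (clear_denominator _ _ (denq b * denq c * denq d)); congr intr; ring.
have [B hB] : exists y : int, m * b = y%:~R.
  by apply: (clear_denominator _ _ (denq a * denq c * denq d)); congr intr; ring.
have [C hC] : exists y : int, m * c = y%:~R.
  by apply: (clear_denominator _ _ (denq a * denq b * denq d)); congr intr; ring.
have [D hD] : exists y : int, m * d = y%:~R.
  by apply: (clear_denominator _ _ (denq a * denq b * denq c)); congr intr; ring.
pose g := gcdz (gcdz A B) (gcdz C D).
have dv1 : (g %| gcdz A B)%Z by rewrite dvdz_gcdl.
have dv2 : (g %| gcdz C D)%Z by rewrite dvdz_gcdr.
have /dvdzP[A' eA] : (g %| A)%Z by apply: dvdz_trans dv1 _; rewrite dvdz_gcdl.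
have /dvdzP[B' eB] : (g %| B)%Z by apply: dvdz_trans dv1 _; rewrite dvdz_gcdr.
have /dvdzP[C' eC] : (g %| C)%Z by apply: dvdz_trans dv2 _; rewrite dvdz_gcdl.
have /dvdzP[D' eD] : (g %| D)%Z by apply: dvdz_trans dv2 _; rewrite dvdz_gcdr.
have [[u1 [v1 e1]] [u2 [v2 e2]]] := (Bezoutz A B, Bezoutz C D).
have [u3 [v3 e3]] := Bezoutz (gcdz A B) (gcdz C D).
have g0 : g != 0.
  apply: contraTneq nz => gz; rewrite !negb_or !negbK.
  have zero (x : rat) (X X' : int) : m * x = X%:~R -> X = X' * g -> x == 0.
    by move=> h e; apply/eqP/(mulfI m0); rewrite mulr0 h e gz mulr0 mulr0z.
  rewrite (zero _ _ _ hA eA) (zero _ _ _ hB eB).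
  by rewrite (zero _ _ _ hC eC) (zero _ _ _ hD eD).
exists (g%:~R / m); split; first by apply: mulf_neq0; rewrite ?invr_eq0 // intr_eq0.
exists A', B', C', D'; split.
  exists (u3 * u1), (u3 * v1), (v3 * u2), (v3 * v2).
  apply: (mulIf g0); rewrite mul1r -[RHS]e3 -e1 -e2.
  rewrite [in RHS]eA [in RHS]eB [in RHS]eC [in RHS]eD; ring.
have back (x : rat) (X X' : int) : m * x = X%:~R -> X = X' * g -> x = g%:~R / m * X'%:~R.
  move=> h1 h2; apply: (mulfI m0); rewrite h1 h2 rmorphM /=.
  by rewrite mulrA (mulrCA m) mulfV // mulr1 mulrC.
split; by [apply: back hA _|apply: back hB _|apply: back hC _|apply: back hD _].
Qed.

Lemma rotation_primitive_quaternion (M : 'M[rat]_3) :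
  M *m M^T = 1%:M -> \det M = 1 ->
  exists a b c d : int, primitive4 a b c d /\
    map_mx intr (qrot a b c d) = (qnorm a b c d)%:~R *: M.
Proof.
move=> MMt detM; have [a [b [c [d [n0 e]]]]] := rotation_quaternion MMt detM.
have [|t [t0 [a' [b' [c' [d' [pr [ea eb ec ed]]]]]]]] := @rat_quadruple_primitive a b c d.
  apply: contraNT n0; rewrite !negb_or !negbK => /and4P[/eqP-> /eqP-> /eqP-> /eqP->].
  by rewrite /qnorm expr0n /= !addr0.
exists a', b', c', d'; split=> //.
have h (x y z w : int) : (qnorm x y z w)%:~R = qnorm x%:~R y%:~R z%:~R w%:~R :> rat.
  by rewrite /qnorm !rmorphD !rmorphXn.
have h' (x y z w : int) : map_mx intr (qrot x y z w) =
    qrot x%:~R y%:~R z%:~R w%:~R :> 'M[rat]_3.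
  by apply/matrixP; do 2 apply: forall_ord3; rewrite !mxE /=; ring.
rewrite h h'; apply: (scalerI (_ : t ^+ 2 != 0)); first by rewrite expf_neq0.
rewrite -qrotZ -ea -eb -ec -ed e scalerA; congr (_ *: M).
rewrite /qnorm ea eb ec ed; ring.
Qed.

(** * Vectors of large order modulo a sublattice *)

(** By the Chinese remainder theorem [t] may be chosen prime by prime: it has to
    vanish modulo [p] when [u] does not, and to be invertible modulo [p]
    otherwise.  The product of the primes of the first kind does this. *)
Lemma exists_comb_indivisible n d (u v : 'rV[int]_n) : (0 < d)%N ->
  exists t : int, forall p, prime p -> (p %| d)%N ->
    (exists j, ~~ (p %| u ord0 j)%Z) \/ (exists j, ~~ (p %| v ord0 j)%Z) ->
    exists j, ~~ (p %| (u + t *: v) ord0 j)%Z.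
Proof.
move=> d0.
pose good p := [exists j, ~~ (p%:Z %| u ord0 j)%Z].
exists (\prod_(p <- primes d | good p) p)%N%:Z => p pp pd uvp.
have mem_p : p \in primes d by rewrite mem_primes pp d0.
have [gp|bp] := boolP (good p).
  have /existsP[j nj] := gp; exists j; rewrite !mxE rpredDr //.
  by apply: dvdz_mulr; rewrite dvdzE /= (big_rem p) //= gp dvdn_mulr.
have [/existsP gp|[j vj]] := uvp; first by rewrite /good gp in bp.
have uj : (p %| u ord0 j)%Z.
  by move: (bp); rewrite negb_exists => /forallP/(_ j)/negPn.
exists j; rewrite !mxE rpredDl //.
rewrite dvdzE abszM /= Euclid_dvdM // negb_or vj andbT.
rewrite Euclid_dvd_prod //; apply/negP; rewrite big_has_cond => /hasP[r].
rewrite mem_primes => /and3P[pr _ _] /andP[gr].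
by rewrite dvdn_prime2 // => /eqP e; move: bp; rewrite e gr.
Qed.

Lemma dvdz_of_coprime_row n d (u : 'rV[int]_n) (s : int) : (0 < d)%N ->
  (forall p, prime p -> (p %| d)%N -> exists j, ~~ (p %| u ord0 j)%Z) ->
  (forall j, d%:Z %| s * u ord0 j)%Z -> (d%:Z %| s)%Z.
Proof.
move=> d0 ud H.
pose g := gcdn d `|s|%N.
have g0 : (0 < g)%N by rewrite gcdn_gt0 d0.
have dE : d = ((d %/ g) * g)%N by rewrite divnK // dvdn_gcdl.
have sE : `|s|%N = ((`|s| %/ g) * g)%N by rewrite divnK // dvdn_gcdr.
have cop : coprime (d %/ g) (`|s| %/ g).
  by rewrite /coprime -(eqn_pmul2r g0) muln_gcdl -dE -sE mul1n.
have d'0 : (0 < d %/ g)%N by rewrite divn_gt0 // dvdn_leq // dvdn_gcdl.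
have [|d'1] := leqP (d %/ g) 1.
  case: (d %/ g)%N d'0 dE => [|[|]] // _; rewrite mul1n => -> _.
  by rewrite dvdzE /= dvdn_gcdr.
have [] := ud (pdiv (d %/ g)); first exact: pdiv_prime.
  by rewrite {2}dE dvdn_mulr // pdiv_dvd.
move=> j /negP[]; rewrite dvdzE /=; apply: dvdn_trans (pdiv_dvd _) _.
rewrite -(Gauss_dvdr _ cop) -(dvdn_pmul2r g0) -dE mulnAC -sE -abszM.
exact: H.
Qed.

(** The integer row vectors [x] with [n] dividing [x *m A] form a sublattice.
    After division of [A] and [n] by their common divisor [g], every prime factor
    of [d = n / g] misses an entry of the quotient [B], so some combination [k] of
    the rows of [B] is nonzero modulo each of them; the order of [k] modulo the
    sublattice is then exactly [d]. *)
Lemma exists_large_order (A : 'M[int]_3) (n h : nat) : (0 < n)%N ->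
  (forall g : int, (g %| n%:Z)%Z -> (forall i j, g %| A i j)%Z -> (g %| h%:Z)%Z) ->
  (0 < h)%N ->
  exists k : 'rV[int]_3, exists d : nat, (n <= h * d)%N /\
    forall s : int, (forall j, n%:Z %| s * (k *m A) ord0 j)%Z -> (d%:Z %| s)%Z.
Proof.
move=> n0 H h0.
pose G := (\big[gcdn/0]_(ij : 'I_3 * 'I_3) `|A ij.1 ij.2|)%N.
pose g := gcdn n G.
have g0 : (0 < g)%N by rewrite gcdn_gt0 n0.
have gA i j : (g %| A i j)%Z.
  by rewrite dvdzE /=; apply: dvdn_trans (dvdn_gcdr _ _) _; apply: (biggcdn_inf (i, j)).
pose d := (n %/ g)%N.
have nE : n = (d * g)%N by rewrite divnK // dvdn_gcdl.
have d0 : (0 < d)%N by rewrite divn_gt0 // dvdn_leq // dvdn_gcdl.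
pose B : 'M[int]_3 := \matrix_(i, j) (A i j %/ g)%Z.
have AE : A = g%:Z *: B by apply/matrixP => i j; rewrite !mxE mulrC divzK.
have Bcop p : prime p -> (p %| d)%N -> exists i j, ~~ (p %| B i j)%Z.
  move=> pp pd.
  suff /existsP[i /existsP[j nB]] : [exists i, [exists j, ~~ (p%:Z %| B i j)%Z]].
    by exists i, j.
  apply: contraT => /existsPn allB.
  suff : (p * g %| gcdn n G)%N.
    by rewrite -/g -{2}[g]mul1n dvdn_pmul2r // dvdn1 => /eqP p1; rewrite p1 in pp.
  rewrite dvdn_gcd {1}nE dvdn_pmul2r // pd /=.
  apply/dvdn_biggcdP => -[i j] _ /=.
  rewrite AE mxE abszM /= mulnC dvdn_pmul2l //.
  by have /existsPn/(_ j) := allB i; rewrite negbK.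
have [t1 H1] := exists_comb_indivisible (row e0 B) (row e1 B) d0.
have [t2 H2] := exists_comb_indivisible (row e0 B + t1 *: row e1 B) (row e2 B) d0.
pose k : 'rV[int]_3 := delta_mx 0 e0 + t1 *: delta_mx 0 e1 + t2 *: delta_mx 0 e2.
have kB : k *m B = row e0 B + t1 *: row e1 B + t2 *: row e2 B.
  by rewrite !mulmxDl -!scalemxAl -!rowE.
exists k, d; split.
  have /dvdn_leq := H g%:Z (dvdn_gcdl _ _) gA.
  by rewrite nE mulnC leq_pmul2r //; apply.
move=> s Hs; apply: (@dvdz_of_coprime_row _ _ (k *m B) _ d0).
  move=> p pp pd; rewrite kB; apply: (H2 p pp pd).
  have [i [j nB]] := Bcop p pp pd; move: i nB.
  apply: forall_ord3 => nB; [left; apply: (H1 p pp pd); left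
    |left; apply: (H1 p pp pd); right | right]; by exists j; rewrite mxE.
move=> j; have := Hs j.
rewrite AE -scalemxAr mxE mulrCA nE PoszM [X in (X %| _)%Z]mulrC dvdz_mul2l //.
by rewrite -lt0n.
Qed.

(** * Points of a sublattice in a box *)
Definition intmx m n N (x : 'M['I_N]_(m, n)) : 'M[int]_(m, n) :=
  map_mx (fun i : 'I_N => Posz i) x.

Lemma intmx_inj m n N : injective (@intmx m n N).
Proof.
move=> x y /matrixP e; apply/matrixP => i j; have := e i j.
by rewrite !mxE => -[/val_inj].
Qed.

(** Taking fractional parts of the coordinates of [v] in the basis of the rows of
    [X] moves [v] into the half-open parallelepiped spanned by these rows. *)
Lemma reduce_mod_rows (Q : nat) (X : 'M[int]_3) (v : 'rV[int]_3) :
  (forall i j, 0 <= X i j <= Q%:Z) -> \det X != 0 ->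
  {c : 'rV[int]_3 | forall j, 0 <= (v - c *m X) 0 j <= (3 * Q)%:Z}.
Proof.
move=> Xbd detX.
pose XQ : 'M[rat]_3 := map_mx intr X.
have XQu : XQ \in unitmx by rewrite unitmxE unitfE det_map_mx intr_eq0.
pose w := map_mx intr v *m invmx XQ.
have vE : map_mx intr v = w *m XQ by rewrite mulmxKV.
clearbody w; pose c : 'rV[int]_3 := \row_j Num.floor (w 0 j).
have cE i : c 0 i = Num.floor (w 0 i) by rewrite mxE.
clearbody c.
exists c => j.
have eq_vX : ((v - c *m X) 0 j)%:~R = \sum_i (w 0 i - (c 0 i)%:~R) * (X i j)%:~R :> rat.
  transitivity ((map_mx intr (v - c *m X) : 'rV[rat]_3) 0 j); first by rewrite [RHS]mxE.
  rewrite map_mxB map_mxM /= -/XQ vE -mulmxBl mxE.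
  by apply: eq_bigr => i _; rewrite !mxE.
have term i : (0 : rat) <= (w 0 i - (c 0 i)%:~R) * (X i j)%:~R <= Q%:R.
  have /andP[f0 f1] : 0 <= w 0 i - (c 0 i)%:~R <= 1.
    have /andP[] := Num.Theory.floor_itv (w 0 i); rewrite cE intrD => ? ?.
    by apply/andP; split; lra.
  have /andP[Xij0 XijQ] := Xbd i j.
  rewrite -(ler0z rat) in Xij0; rewrite -(ler_int rat) in XijQ.
  by rewrite mulr_ge0 //= -[leRHS]mul1r ler_pM.
rewrite -(ler0z rat) -(ler_int rat) eq_vX sumr_ge0 => [|i _]; last first.
  by case/andP: (term i).
apply: (@le_trans _ _ (\sum_(i < 3) (Q%:R : rat))).
  by apply: ler_sum => i _; case/andP: (term i).
by rewrite sumr_const card_ord -pmulrn natrM mulr_natl.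
Qed.

(** The points [x] of the sublattice in the box, translated by the reductions
    [r t] of the [d] vectors [t *: k], are pairwise distinct: an equality between
    two translates puts [(t - u) *: k] in the sublattice, whence [t = u].  All
    translates lie in the box of side [Q + 3 * Q]. *)
Lemma card_sublattice_box (Q n d : nat) (A X : 'M[int]_3) (k : 'rV[int]_3) :
  (forall i j, 0 <= X i j <= Q%:Z) -> \det X != 0 ->
  (forall i j, n%:Z %| (X *m A) i j)%Z ->
  (forall s : int, (forall j, n%:Z %| s * (k *m A) ord0 j)%Z -> (d%:Z %| s)%Z) ->
  (#|[pred x : 'rV['I_Q.+1]_3 | [forall j, n%:Z %| (intmx x *m A) ord0 j]%Z]| * d
    <= (4 * Q).+1 ^ 3)%N.
Proof.
move=> Xbd detX XA ordk.
have red (t : 'I_d) := @reduce_mod_rows Q X (t%:Z *: k) Xbd detX.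
pose r (t : 'I_d) := (t%:Z *: k) - sval (red t) *m X.
have r_bd t j : 0 <= r t 0 j <= (3 * Q)%:Z := svalP (red t) j.
pose f (p : 'rV['I_Q.+1]_3 * 'I_d) : 'rV['I_(4 * Q).+1]_3 :=
  \row_j inord (absz ((intmx p.1 + r p.2) 0 j)).
pose L := [pred x : 'rV['I_Q.+1]_3 | [forall j, n%:Z %| (intmx x *m A) ord0 j]%Z].
have fE p : intmx (f p) = intmx p.1 + r p.2.
  apply/rowP => j; rewrite /f [LHS]mxE [X in Posz (nat_of_ord X)]mxE.
  have := r_bd p.2 j; have : 0 <= intmx p.1 0 j <= Q%:Z.
    by rewrite mxE; have := ltn_ord (p.1 0 j); lia.
  rewrite [fun_of_matrix (_ + _) _ _]mxE; move: (intmx _ _ _) (r _ _ _) => a b ab bb.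
  by rewrite inordK; lia.
have <- : #|[pred p : 'rV['I_Q.+1]_3 * 'I_d | L p.1]| = (#|L| * d)%N.
  rewrite -[d in RHS]card_ord -cardX; apply: eq_card => p.
  by rewrite !inE andbT.
have <- : #|'rV['I_(4 * Q).+1]_3| = ((4 * Q).+1 ^ 3)%N.
  by rewrite card_mx card_ord mul1n.
apply: (@leq_card_in _ _ f) => -[x t] [y u]; rewrite !inE /= => /forallP Lx /forallP Ly.
move=> /(congr1 (@intmx _ _ _)); rewrite !fE /= => e.
have tu : t = u.
  have dtu : (d%:Z %| t%:Z - u%:Z)%Z.
    apply: ordk => j.
    have tuk : (t%:Z - u%:Z) *: k =
        intmx y - intmx x + (sval (red t) - sval (red u)) *m X.
      apply/rowP => i; have := congr1 (fun M : 'rV[int]_3 => M 0 i) e.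
      rewrite /r scalerBl mulmxBl.
      rewrite ![fun_of_matrix (_ + _) _ _]mxE ![fun_of_matrix (- _) _ _]mxE.
      by do 6 move: (fun_of_matrix _ _ _) => ?; lia.
    have -> : (t%:Z - u%:Z) * (k *m A) ord0 j =
        (intmx y *m A) ord0 j - (intmx x *m A) ord0 j +
        ((sval (red t) - sval (red u)) *m (X *m A)) ord0 j.
      transitivity ((((t%:Z - u%:Z) *: k) *m A) ord0 j).
        by rewrite -scalemxAl [RHS]mxE.
      rewrite tuk mulmxDl mulmxBl mulmxA.
      by rewrite ![fun_of_matrix (_ + _) _ _]mxE ![fun_of_matrix (- _) _ _]mxE.
    rewrite rpredD // ?rpredB // mxE rpred_sum // => i _.
    exact: dvdz_mull.
  apply/val_inj/eqP; rewrite -eqz_nat -subr_eq0 -absz_eq0 -leqn0 leqNgt.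
  apply/negP => /dvdn_leq/(_ dtu) /=; have := ltn_ord t; have := ltn_ord u; lia.
congr (_, _) => //; apply: intmx_inj.
by move: e; rewrite tu => /addIr.
Qed.

(** * A convergent sum over quadruples *)

(** The cutoff at 1 makes the origin harmless. *)
Definition invcube (F : fieldType) (s : nat) : F := (maxn s 1)%:R^-1 ^+ 3.

(** There are [2 * k + 1] pairs with maximum [k], and
    [(2 * k + 1) / k ^ 3 <= 6 / (k * (k + 1))] telescopes. *)
Lemma sum_square_invcube (F : realFieldType) N :
  \sum_(0 <= a < N) \sum_(0 <= b < N) invcube F (maxn a b) <= 7.
Proof.
have step k : \sum_(0 <= a < k.+1) \sum_(0 <= b < k.+1) invcube F (maxn a b) =
   \sum_(0 <= a < k) \sum_(0 <= b < k) invcube F (maxn a b)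
     + (2 * k + 1)%:R * invcube F k.
  have left_column a : (a < k)%N -> \sum_(0 <= b < k.+1) invcube F (maxn a b) =
      \sum_(0 <= b < k) invcube F (maxn a b) + invcube F k.
    by move=> ak; rewrite big_nat_recr //= (maxn_idPr (ltnW ak)).
  have last_row : \sum_(0 <= b < k) invcube F (maxn k b) = invcube F k *+ k.
    rewrite -[X in _ *+ X]subn0 -sumr_const_nat; apply: eq_big_nat => b /andP[_ bk].
    by rewrite (maxn_idPl (ltnW bk)).
  rewrite big_nat_recr //= big_nat_recr //= maxnn last_row.
  rewrite (eq_big_nat _ _ (fun a ak => left_column a (proj2 (elimT andP ak)))).
  rewrite big_split /= sumr_const_nat subn0 -!addrA; congr (_ + _).
  by rewrite natrD natrM -mulr_natl; ring.
suff H k : \sum_(0 <= a < k.+1) \sum_(0 <= b < k.+1) invcube F (maxn a b)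
    <= 7 - 6 * k.+1%:R^-1.
  case: N => [|N]; first by rewrite big_geq.
  by apply: le_trans (H N) _; rewrite lerBlDr lerDl mulr_ge0 // invr_ge0.
elim: k => [|k IH].
  by rewrite step big_geq // /invcube max0n invr1 expr1n; lra.
rewrite step; apply: le_trans (lerD IH (lexx _)) _.
rewrite /invcube (maxn_idPl (ltn0Sn k)) //.
have k0 : 0 < k.+1%:R :> F by rewrite ltr0n.
have k1 : k.+2%:R = k.+1%:R + 1 :> F by rewrite -natr1.
have k2 : (2 * k.+1 + 1)%:R = 2 * k.+1%:R + 1 :> F by rewrite natrD natrM.
rewrite k1 k2; have k3 : 1 <= k.+1%:R :> F by rewrite ler1n.
move: k0 k3; move: (k.+1%:R) => x x0 x1.
rewrite -subr_ge0.
have -> : 7 - 6 * (x + 1)^-1 - (7 - 6 * x^-1 + (2 * x + 1) * x^-1 ^+ 3)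
   = (4 * x ^+ 2 - 3 * x - 1) / (x ^+ 3 * (x + 1)).
  by field; rewrite !gt_eqF //; lra.
apply: divr_ge0; first by nra.
by rewrite mulr_ge0 ?exprn_ge0 //; lra.
Qed.

(** Signed integers of absolute value at most [B] as a finite type; zero is
    coded twice, which only weakens upper bounds. *)
Definition sint B (z : bool * 'I_B.+1) : int := (-1) ^+ z.1 * z.2%:Z.

Lemma sint_surj B (z : int) : (`|z| <= B)%N -> exists c : bool * 'I_B.+1, sint c = z.
Proof.
move=> zB; exists (z < 0, inord `|z|%N); rewrite /sint /= inordK ?ltnS //.
by rewrite -intEsign.
Qed.

Lemma sum_pairs_invcube (F : realFieldType) B :
  \sum_(p : (bool * 'I_B.+1) * (bool * 'I_B.+1)) invcube F (maxn p.1.2 p.2.2) <= 28.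
Proof.
rewrite -(pair_bigA _ (fun x y : bool * 'I_B.+1 => invcube F (maxn x.2 y.2))) /=.
have inner x : \sum_(y : bool * 'I_B.+1) invcube F (maxn x y.2) =
    2 * \sum_(b < B.+1) invcube F (maxn x b).
  rewrite -(pair_bigA _ (fun (s : bool) (y : 'I_B.+1) => invcube F (maxn x y))) /=.
  by rewrite big_bool mulr2n mulrDl mul1r.
under eq_bigr do rewrite inner.
rewrite -big_distrr /=.
rewrite -(pair_bigA _ (fun (s : bool) (x : 'I_B.+1) =>
  \sum_(b < B.+1) invcube F (maxn x b))) /=.
rewrite big_bool /=.
have := sum_square_invcube F B.+1; rewrite big_mkord.
rewrite (eq_bigr (fun x : 'I_B.+1 =>
  \sum_(b < B.+1) invcube F (maxn x b))) => [|x _].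
  lra.
by rewrite big_mkord.
Qed.

Definition qcode B :=
  ((bool * 'I_B.+1) * (bool * 'I_B.+1) *
   ((bool * 'I_B.+1) * (bool * 'I_B.+1)))%type.

Definition codenorm B (q : qcode B) : int :=
  qnorm (sint q.1.1) (sint q.1.2) (sint q.2.1) (sint q.2.2).

(** The norm of [(a, b, c, d)] is at least [max(a, b) ^ 2] and at least
    [max(c, d) ^ 2], hence at least their geometric mean, so the sum is bounded by
    the square of a sum over pairs.  At the origin the summand is [0^-1 ^+ 3],
    which is 0. *)
Lemma sum_inv_norm_cube (F : realFieldType) B :
  \sum_(q : qcode B) (codenorm q)%:~R^-1 ^+ 3 <= 28 ^+ 2 :> F.
Proof.
rewrite expr2.
have s0 := sum_pairs_invcube F B.
have i0 s : 0 <= invcube F s by rewrite exprn_ge0 // invr_ge0.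
apply: le_trans (ler_pM _ _ s0 s0); rewrite ?sumr_ge0 //.
rewrite big_distrl /=; under [leRHS]eq_bigr do rewrite big_distrr /=.
rewrite pair_bigA /=; apply: ler_sum => -[[[sa a] [sb b]] [[sc c] [sd d]]] _ /=.
rewrite /codenorm /qnorm /sint /= !exprMn !sqrr_sign !mul1r.
set n := (_ + _ : int).
have nn : n = (a ^ 2 + b ^ 2 + c ^ 2 + d ^ 2)%N by rewrite /n; lia.
rewrite nn -pmulrn /invcube -exprMn.
have [->|n0] := posnP (a ^ 2 + b ^ 2 + c ^ 2 + d ^ 2)%N.
  by rewrite invr0 expr0n exprn_ge0 // mulr_ge0 // invr_ge0.
rewrite lerXn2r ?nnegrE ?mulr_ge0 ?invr_ge0 // -invfM -natrM.
rewrite lef_pV2 ?posrE ?ltr0n //; last first.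
  by rewrite muln_gt0 !leq_max !orbT.
move: n0 {nn}; rewrite ler_nat.
move: (a : nat) (b : nat) (c : nat) (d : nat) => {n a b c d} a b c d n0.
set u := maxn (maxn a b) 1; set v := maxn (maxn c d) 1.
have un : (u ^ 2 <= a ^ 2 + b ^ 2 + c ^ 2 + d ^ 2)%N.
  have [->|[->|->]] : u = a \/ u = b \/ u = 1%N by rewrite /u; lia.
  - lia.
  - lia.
  - by rewrite exp1n.
have vn : (v ^ 2 <= a ^ 2 + b ^ 2 + c ^ 2 + d ^ 2)%N.
  have [->|[->|->]] : v = c \/ v = d \/ v = 1%N by rewrite /v; lia.
  - lia.
  - lia.
  - by rewrite exp1n.
rewrite -(leq_pmul2l (isT : 0 < 2)%N); apply: leq_trans (nat_Cauchy u v) _.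
by rewrite mul2n -addnn leq_add.
Qed.

(** * Counting pairs with the same Gram matrix *)
Lemma card_le_sum_cover (I T : finType) (P : pred T) (S : I -> pred T) :
  (forall x, P x -> exists i, S i x) -> (#|P| <= \sum_i #|S i|)%N.
Proof.
move=> PS; rewrite -sum1_card.
under [leqRHS]eq_bigr do rewrite -sum1_card big_mkcond /=.
rewrite exchange_big big_mkcond /=; apply: leq_sum => x _.
case: ifP => // /PS[i Si]; rewrite (bigD1 i) //= ifT //.
Qed.

(** The numbers [4 * x * y], for [x, y] among [a, b, c, d], are integer
    combinations of the norm and the entries of the Euler-Rodrigues matrix; and 4
    is a combination of them by the square of a Bezout identity. *)
Lemma primitive_qrot_gcd (a b c d g : int) : primitive4 a b c d ->
  (g %| qnorm a b c d)%Z -> (forall i j, g %| qrot a b c d i j)%Z -> (g %| 4)%Z.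
Proof.
move=> [u [v [w [x e]]]] gn gA.
pose A := qrot a b c d.
have -> : 4 = 4 * (u * a + v * b + w * c + x * d) ^+ 2 :> int by rewrite e.
have -> : 4 * (u * a + v * b + w * c + x * d) ^+ 2 =
  u ^+ 2 * (qnorm a b c d + A e0 e0 + A e1 e1 + A e2 e2)
  + v ^+ 2 * (qnorm a b c d + A e0 e0 - A e1 e1 - A e2 e2)
  + w ^+ 2 * (qnorm a b c d - A e0 e0 + A e1 e1 - A e2 e2)
  + x ^+ 2 * (qnorm a b c d - A e0 e0 - A e1 e1 + A e2 e2)
  + 2 * (u * v * (A e2 e1 - A e1 e2) + u * w * (A e0 e2 - A e2 e0)
         + u * x * (A e1 e0 - A e0 e1) + v * w * (A e0 e1 + A e1 e0)
         + v * x * (A e0 e2 + A e2 e0) + w * x * (A e1 e2 + A e2 e1)) :> int.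
  by rewrite !mxE /= /qnorm; ring.
by do ?[exact: gn | exact: gA | apply: rpredD | rewrite rpredN | apply: dvdz_mull].
Qed.

Lemma primitive_qnorm_gt0 (a b c d : int) : primitive4 a b c d -> 0 < qnorm a b c d.
Proof.
move=> [u [v [w [x e]]]]; rewrite lt_neqAle eq_sym /qnorm !addr_ge0 ?sqr_ge0 // andbT.
apply/negP; rewrite !paddr_eq0 ?addr_ge0 ?sqr_ge0 // !sqrf_eq0.
move=> /andP[/andP[/andP[/eqP a0 /eqP b0] /eqP c0] /eqP d0].
by move: e; rewrite a0 b0 c0 d0 !mulr0.
Qed.

(** [M = X^-1 Y] is orthogonal over the rationals; the sign [s] makes its
    determinant 1. *)
Lemma isometric_quaternion (X Y : 'M[int]_3) :
  \det X != 0 -> Y *m Y^T = X *m X^T ->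
  exists (s : bool) (a b c d : int), primitive4 a b c d /\
    qnorm a b c d *: Y = (-1) ^+ s *: (X *m qrot a b c d).
Proof.
move=> detX YX.
have [XQ XQE] : {XQ : 'M[rat]_3 | XQ = map_mx intr X} by exists (map_mx intr X).
have [YQ YQE] : {YQ : 'M[rat]_3 | YQ = map_mx intr Y} by exists (map_mx intr Y).
have XQu : XQ \in unitmx by rewrite unitmxE unitfE XQE det_map_mx intr_eq0.
have YXQ : YQ *m YQ^T = XQ *m XQ^T.
  by rewrite XQE YQE !map_trmx -!map_mxM YX.
pose M := invmx XQ *m YQ.
have MMt : M *m M^T = 1%:M.
  rewrite trmx_mul mulmxA -[_ *m _ *m YQ^T]mulmxA YXQ mulmxA mulVmx // mul1mx.
  by rewrite trmx_inv mulmxV // unitmx_tr.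
have : \det M ^+ 2 == 1 by rewrite expr2 -{2}det_tr -det_mulmx MMt det1.
rewrite sqrf_eq1 => detM.
pose s := \det M == -1.
have [] := @rotation_primitive_quaternion ((-1) ^+ s *: M).
- by rewrite linearZ /= -scalemxAl -scalemxAr scalerA -signr_addb addbb scale1r.
- rewrite detZ /s; case/orP: detM => /eqP->; last by rewrite eqxx; ring.
  by rewrite (_ : 1 == -1 = false) // expr0 expr1n mul1r.
move=> a [b [c [d [prim e]]]]; exists s, a, b, c, d; split=> //.
have inj : injective (map_mx intr : 'M[int]_3 -> 'M[rat]_3).
  move=> U V /matrixP h; apply/matrixP => i j.
  by have := h i j; rewrite !mxE => /intr_inj.
apply: inj; rewrite !map_mxZ map_mxM /= e -XQE -YQE rmorph_sign.
rewrite -!scalemxAr !scalerA mulrCA -signr_addb addbb mulr1.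
by rewrite mulmxA mulmxV // mul1mx.
Qed.

Lemma card_rotation_sublattice_box (Q : nat) (a b c d : int) (X : 'M[int]_3) :
  (forall i j, 0 <= X i j <= Q%:Z) -> \det X != 0 -> primitive4 a b c d ->
  (forall i j, qnorm a b c d %| (X *m qrot a b c d) i j)%Z ->
  (#|[pred x : 'rV['I_Q.+1]_3 |
      [forall j, qnorm a b c d %| (intmx x *m qrot a b c d) ord0 j]%Z]|
     * `|qnorm a b c d| <= 4 * (4 * Q).+1 ^ 3)%N.
Proof.
move=> Xbd detX prim dX.
have n0 := primitive_qnorm_gt0 prim.
have nE : qnorm a b c d = `|qnorm a b c d|%N by rewrite gtz0_abs.
have [|g gn gA|//|k [m [nm ordk]]] :=
    @exists_large_order (qrot a b c d) `|qnorm a b c d|%N 4.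
- by rewrite absz_gt0 gt_eqF.
- by apply: primitive_qrot_gcd prim _ gA; rewrite nE.
rewrite -nE in ordk.
apply: leq_trans (leq_mul (leqnn _) nm) _; rewrite mulnCA leq_pmul2l //.
have := @card_sublattice_box Q `|qnorm a b c d|%N m (qrot a b c d) X k Xbd detX.
by rewrite -nE; apply.
Qed.

(** The four vertices of the tetrahedron coded by [M]: the origin, then the rows
    of [M]. *)
Definition vertex (R : pzRingType) (M : 'M[R]_3) (j : 'I_4) : 'rV[R]_3 :=
  oapp (fun i => row i M) 0 (unlift ord0 j).

Lemma vertexZ (R : pzRingType) (a : R) M j : vertex (a *: M) j = a *: vertex M j.
Proof. by rewrite /vertex; case: unliftP => [i|] _ /=; rewrite ?linearZ // scaler0. Qed.

Lemma vertex_inj (R : pzRingType) (M N : 'M[R]_3) : vertex M =1 vertex N -> M = N.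
Proof.
move=> MN; apply/row_matrixP => i; have := MN (lift ord0 i).
by rewrite /vertex liftK.
Qed.

Section Pairs.
Variables (F : realFieldType) (Q : nat) (T : finType) (X : T -> 'M['I_Q.+1]_3).
Hypotheses (X_inj : injective X) (X_det : forall t, \det (intmx (X t)) != 0).

(** A bound for the norm of every quaternion relating two matrices [X t]: its
    sublattice has a point in the box. *)
Definition maxnorm := (4 * (4 * Q).+1 ^ 3)%N.

Definition coderot (q : qcode maxnorm) : 'M[int]_3 :=
  qrot (sint q.1.1) (sint q.1.2) (sint q.2.1) (sint q.2.2).

Definition codelattice q := [pred x : 'rV['I_Q.+1]_3 |
      [forall j, codenorm q %| (intmx x *m coderot q) ord0 j]%Z].

(** The pairs that a choice of matching [tau], sign [s] and quaternion [q] may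
    account for.  The second condition is the bound provided by
    [card_rotation_sublattice_box]; imposed here, it is available without
    reference to the primitivity of [q]. *)
Definition code_pairs (i : {ffun 'I_4 -> 'I_4} * bool * qcode maxnorm) :=
  [pred p : T * T |
  let: (tau, s, q) := i in
  let W := intmx (X p.1) *m coderot q in
  [&& 0 < codenorm q, (#|codelattice q| * `|codenorm q| <= maxnorm)%N,
   [forall i, row i (X p.1) \in codelattice q]
   & [forall j, codenorm q *: vertex (intmx (X p.2)) j ==
       (-1) ^+ s *: (vertex W (tau j) - vertex W (tau ord0))]]].

(** The first component of such a pair determines the second, and it consists of
    three points of the sublattice. *)
Lemma card_code_pairs i :
  #|code_pairs i|%:R <= (maxnorm%:R * (codenorm i.2)%:~R^-1) ^+ 3 :> F.
Proof.
case: i => -[tau s] q /=.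
have [p pS|S0] := pickP (code_pairs (tau, s, q)); last first.
  rewrite eq_card0 // exprn_ge0 // mulr_ge0 // invr_ge0 ler0z /codenorm /qnorm.
  by rewrite !addr_ge0 ?sqr_ge0.
have /and4P[n0 Nn _ _] := pS.
have nE : codenorm q = `|codenorm q|%N by rewrite gtz0_abs.
have nF : 0 < (codenorm q)%:~R :> F by rewrite ltr0z.
have leN : #|codelattice q|%:R <= maxnorm%:R / (codenorm q)%:~R :> F.
  by rewrite ler_pdivlMr // nE -pmulrn -natrM ler_nat.
apply: le_trans (lerXn2r 3 _ _ leN); rewrite ?nnegrE //; last first.
  by rewrite divr_ge0 // ltW.
rewrite -natrX ler_nat.
have <- : #|[pred f : {ffun 'I_3 -> 'rV['I_Q.+1]_3} |
    f \in ffun_on (codelattice q)]| = (#|codelattice q| ^ 3)%N.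
  by rewrite card_ffun_on card_ord.
pose f (p : T * T) := [ffun i : 'I_3 => row i (X p.1)].
have f_inj : {in code_pairs (tau, s, q) &, injective f}.
  move=> [t u] [t' u'] /and4P[/= _ _ _ /forallP eu] /and4P[/= _ _ _ /forallP eu'].
  move=> /ffunP ef; have tt' : t = t'.
    by apply/X_inj/row_matrixP => i; have := ef i; rewrite !ffunE.
  rewrite -tt' in eu' *; congr (_, _); apply/X_inj/intmx_inj/vertex_inj => j.
  have e : codenorm q *: vertex (intmx (X u)) j =
      codenorm q *: vertex (intmx (X u')) j.
    by rewrite (eqP (eu j)) (eqP (eu' j)).
  apply/rowP => l; apply: (@mulfI _ (codenorm q)); first by rewrite gt_eqF.
  by have := congr1 (fun v : 'rV[int]_3 => v 0 l) e; rewrite [LHS]mxE [RHS]mxE.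
rewrite -(card_in_image f_inj).
apply/subset_leq_card/fintype.subsetP => g /fintype.imageP[p' p'S ->].
rewrite !inE; apply/ffun_onP => i; rewrite ffunE.
by have /and4P[_ _ /forallP rowL _] := p'S; exact: rowL.
Qed.

(** The hypothesis on [E] says that [X u] is obtained from [X t] by an isometry
    fixing the origin, up to translation and renumbering by [tau].  The constant
    counts [4 ^ 4] maps [tau], two signs, and the bound [28 ^+ 2] of
    [sum_inv_norm_cube]. *)
Lemma card_isometric_pairs (E : rel T) :
  (forall t u, E t u -> exists (tau : {ffun 'I_4 -> 'I_4}) (Y : 'M[int]_3),
     Y *m Y^T = intmx (X t) *m (intmx (X t))^T /\
     forall j, vertex (intmx (X u)) j = vertex Y (tau j) - vertex Y (tau ord0)) ->
  #|[pred p : T * T | E p.1 p.2]|%:R <= 512 * 28 ^+ 2 * maxnorm%:R ^+ 3 :> F.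
Proof.
move=> isoE.
have Xbd t i j : 0 <= intmx (X t) i j <= Q%:Z.
  by rewrite mxE; have := ltn_ord (X t i j); lia.
have cover p : E p.1 p.2 -> exists i, code_pairs i p.
  move=> /isoE[tau [Y [YX eV]]].
  have [s [a [b [c [d [prim e]]]]]] := isometric_quaternion (X_det p.1) YX.
  have n0 := primitive_qnorm_gt0 prim.
  have dX i j : (qnorm a b c d %| (intmx (X p.1) *m qrot a b c d) i j)%Z.
    have := congr1 (fun M : 'M[int]_3 => M i j) e; rewrite [LHS]mxE [RHS]mxE => h.
    have -> : (intmx (X p.1) *m qrot a b c d) i j =
        (-1) ^+ s * (qnorm a b c d * Y i j).
      by rewrite h mulrA -signr_addb addbb mul1r.
    by rewrite dvdz_mull // dvdz_mulr.
  have bound := card_rotation_sublattice_box (Xbd p.1) (X_det p.1) prim dX.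
  have rowX i : row i (X p.1) \in [pred x : 'rV['I_Q.+1]_3 |
      [forall j, qnorm a b c d %| (intmx x *m qrot a b c d) ord0 j]%Z].
    rewrite inE; apply/forallP => j.
    have -> : intmx (row i (X p.1)) = row i (intmx (X p.1)) by rewrite /intmx map_row.
    by rewrite -row_mul mxE.
  have n_le : (`|qnorm a b c d| <= maxnorm)%N.
    apply: leq_trans bound; apply: leq_pmull; apply/card_gt0P.
    by exists (row e0 (X p.1)).
  have coord_le (x : int) : x ^+ 2 <= qnorm a b c d -> (`|x| <= maxnorm)%N.
    move=> xn; apply: leq_trans n_le; nia.
  have [a' ea] : exists a', @sint maxnorm a' = a.
    by apply/sint_surj/coord_le; rewrite /qnorm; nia.
  have [b' eb] : exists b', @sint maxnorm b' = b.
    by apply/sint_surj/coord_le; rewrite /qnorm; nia.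
  have [c' ec] : exists c', @sint maxnorm c' = c.
    by apply/sint_surj/coord_le; rewrite /qnorm; nia.
  have [d' ed] : exists d', @sint maxnorm d' = d.
    by apply/sint_surj/coord_le; rewrite /qnorm; nia.
  exists (tau, s, (a', b', (c', d'))).
  rewrite /code_pairs /= /codelattice /coderot /codenorm /= ea eb ec ed n0 bound /=.
  apply/andP; split; first exact/forallP.
  apply/forallP => j; rewrite eV scalerBr -!vertexZ e.
  by rewrite !vertexZ -scalerBr.
apply: (@le_trans _ _ (\sum_i #|code_pairs i|%:R)).
  by rewrite -natr_sum ler_nat; exact: card_le_sum_cover.
apply: le_trans (ler_sum _ (fun i _ => card_code_pairs i)) _.
rewrite -(pair_bigA _ (fun ts q => (maxnorm%:R * (codenorm q)%:~R^-1) ^+ 3)) /=.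
rewrite sumr_const card_prod card_ffun !card_ord card_bool.
under eq_bigr do rewrite exprMn.
rewrite -big_distrr /= -mulrnAr mulrC ler_wpM2r ?exprn_ge0 //.
by rewrite -mulr_natl ler_pM2l ?ltr0n //; exact: sum_inv_norm_cube.
Qed.
End Pairs.

(** * A large family of nondegenerate tetrahedra *)

(** In the Leibniz expansion each of the three negative terms is less than a
    third of the diagonal product, because two diagonal entries have a product at
    least 9 times that of two off-diagonal entries. *)
Lemma det_dominant_gt0 (m : int) (M : 'M[int]_3) :
  (forall i, 0 < M i i) -> (forall i, 3 * m <= M i i) ->
  (forall i j, i != j -> 0 <= M i j <= m) -> 0 < \det M.
Proof.
move=> pos dom off.
have bound i j k l : i != j -> k != l -> 0 <= M i j * M k l <= m ^+ 2.
  by move=> /off/andP[? ?] /off/andP[? ?]; rewrite mulr_ge0 //= expr2 ler_pM.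
have small i j k l r s : i != j -> k != l -> 3 * (M i j * M k l) < M r r * M s s.
  move=> ij kl; have /andP[p0 p1] := bound _ _ _ _ ij kl.
  have m0 : 0 <= m by have /andP[? ?] := off _ _ ij; lia.
  by have := pos r; have := pos s; have := dom r; have := dom s; nia.
have triple r i j k l s u : i != j -> k != l ->
  3 * (M r r * (M i j * M k l)) < M r r * (M s s * M u u).
  by move=> ij kl; rewrite mulrCA ltr_pM2l // small.
have prod_ge0 i j k l r s : i != j -> k != l -> r != s -> 0 <= M i j * M k l * M r s.
  move=> /off/andP[? _] /off/andP[? _] /off/andP[? _].
  by rewrite !mulr_ge0.
have := triple e0 e1 e2 e2 e1 e1 e2 isT isT.
have := triple e1 e0 e2 e2 e0 e0 e2 isT isT.
have := triple e2 e0 e1 e1 e0 e0 e1 isT isT.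
have := prod_ge0 e0 e1 e1 e2 e2 e0 isT isT isT.
have := prod_ge0 e0 e2 e1 e0 e2 e1 isT isT isT.
rewrite det_mx3; lra.
Qed.

(** Diagonal entries in [[Q - m, Q]] and the others in [[0, m]]: for [m] about
    [Q / 4] this family has positive density in the cube and consists of matrices
    with dominant diagonal. *)
Definition dominant Q m (Z : 'M['I_m.+1]_3) : 'M['I_Q.+1]_3 :=
  \matrix_(i, j) inord (if i == j then (Q - Z i j)%N else Z i j).

Lemma dominantE Q m (Z : 'M['I_m.+1]_3) i j : (m <= Q)%N ->
  dominant Q Z i j = (if i == j then (Q - Z i j)%N else Z i j) :> nat.
Proof.
move=> mQ; rewrite mxE inordK // ltnS; have := ltn_ord (Z i j); case: ifP => _; lia.
Qed.

Lemma dominant_inj Q m : (m <= Q)%N -> injective (@dominant Q m).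
Proof.
move=> mQ Z Z' /matrixP e; apply/matrixP => i j; apply: val_inj => /=.
have := congr1 (@nat_of_ord _) (e i j); rewrite !dominantE //.
have := ltn_ord (Z i j); have := ltn_ord (Z' i j); case: ifP => _; lia.
Qed.

Lemma det_dominant_neq0 Q m (Z : 'M['I_m.+1]_3) : (0 < Q)%N -> (4 * m <= Q)%N ->
  \det (intmx (dominant Q Z)) != 0.
Proof.
move=> Q0 mQ; rewrite gt_eqF //; apply: (@det_dominant_gt0 m%:Z) => [i|i|i j ij];
  rewrite mxE dominantE ?eqxx ?(negPf ij); try lia.
- by have := ltn_ord (Z i i); lia.
- by have := ltn_ord (Z i i); lia.
by have := ltn_ord (Z i j); lia.
Qed.

Local Open Scope classical_set_scope.

(** * From Euclidean congruence to integer matrices *)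
Section Geometry.
Variables (R : realType) (q : R).
Hypothesis q0 : 0 <= q.
Let Q := Num.truncn q.

Definition real_row N (x : 'rV['I_N]_3) : 'rV[R]_3 :=
  map_mx (fun i : 'I_N => (i : nat)%:R) x.

Lemma lattice_cube_real_row (x : 'rV['I_Q.+1]_3) : lattice_cube q (real_row x).
Proof.
move=> i; rewrite mxE; split=> //.
by rewrite -truncn_ge_nat // -ltnS.
Qed.

Lemma lattice_cubeP (x : 'rV[R]_3) :
  lattice_cube q x -> exists y : 'rV['I_Q.+1]_3, x = real_row y.
Proof.
move=> xq; exists (\row_j inord (Num.truncn (x 0 j)) : 'rV['I_Q.+1]_3).
apply/rowP => j; have [xint x0 xjq] := xq j; rewrite !mxE inordK.
  by rewrite truncnK // natrEint xint x0.
by rewrite ltnS le_truncn.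
Qed.

Lemma finite_tetrahedra : finite_set (tetrahedra q).
Proof.
pose F (f : {ffun 'I_4 -> 'rV['I_Q.+1]_3}) : set 'rV[R]_3 :=
  range (fun j => real_row (f j)).
apply: (@sub_finite_set _ _ (range F)); last first.
  exact: finite_image.
move=> S [v [-> _ vq]].
have /choice[g gE] : forall j, exists y : 'rV['I_Q.+1]_3, v j = real_row y.
  by move=> j; apply/lattice_cubeP/vq; exists j.
exists [ffun j => g j] => //.
by rewrite /F; congr (image _ _); apply/funext => j; rewrite ffunE gE.
Qed.

Lemma finite_T3 : finite_set (T3 q).
Proof. exact: finite_image finite_tetrahedra. Qed.

Definition corner (X : 'M['I_Q.+1]_3) (j : 'I_4) : 'rV[R]_3 :=
  map_mx intr (vertex (intmx X) j).

Lemma corner0 X : corner X ord0 = 0.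
Proof. by rewrite /corner /vertex unlift_none /= map_mx0. Qed.

Lemma tetrahedra_corner (X : 'M['I_Q.+1]_3) : \det (intmx X) != 0 ->
  tetrahedra q (range (corner X)).
Proof.
move=> detX; exists (corner X); split=> //; last first.
  move=> _ [j _ <-] i; rewrite /corner /vertex.
  case: unliftP => [k|] _ /=; rewrite !mxE.
    have [] := @lattice_cube_real_row (row k X) i.
    by rewrite !mxE => ? ? ?; split.
  by split; rewrite ?rpred0.
pose XR : 'M[R]_3 := map_mx intr (intmx X).
have XRu : XR \in unitmx by rewrite unitmxE unitfE det_map_mx intr_eq0.
have cornerE (i : 'I_3) : corner X (lift ord0 i) - corner X ord0 = row i XR.
  by rewrite corner0 subr0 /corner /vertex liftK /= map_row.
rewrite /affinely_independent.
rewrite (_ : [seq _ | i : 'I_3] = [tuple row i XR | i < 3]); last first.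
  by apply: eq_map => i; exact: cornerE.
apply/freeP => k sum0 i.
have kX : (\row_i k i) *m XR = 0.
  rewrite mulmx_sum_row -[RHS]sum0; apply: eq_bigr => j _.
  by rewrite mxE (nth_map j) ?size_enum_ord // nth_ord_enum.
have := congr1 (fun v => (v *m invmx XR) 0 i) kX.
by rewrite mulmxK // mul0mx !mxE.
Qed.

Definition dot (u v : 'rV[R]_3) : R := (u *m v^T) 0 0.

(** Polarization: distances determine scalar products, hence Gram matrices. *)
Lemma dot_edist (u v w : 'rV[R]_3) :
  dot (u - w) (v - w) =
    (Defs.edist u w ^+ 2 + Defs.edist v w ^+ 2 - Defs.edist u v ^+ 2) / 2.
Proof.
have edist2 (x y : 'rV[R]_3) : Defs.edist x y ^+ 2 = \sum_i (x 0 i - y 0 i) ^+ 2.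
  by rewrite sqr_sqrtr // sumr_ge0 // => i _; exact: sqr_ge0.
by rewrite !edist2 /dot mxE !sum_ord3 !mxE; lra.
Qed.

(** An isometry [f] between the vertex sets sends differences of corners of [X] to
    differences of corners of [X'], which are integral; these are the rows of [Y].
    As the first corner of [X'] is the origin, [X'] is read off from [Y] and the
    preimages [tau] of its corners. *)
Lemma isometric_corners (X X' : 'M['I_Q.+1]_3) :
  congruent (range (corner X)) (range (corner X')) ->
  exists (tau : {ffun 'I_4 -> 'I_4}) (Y : 'M[int]_3),
     Y *m Y^T = intmx X *m (intmx X)^T /\
     forall j, vertex (intmx X') j = vertex Y (tau j) - vertex Y (tau ord0).
Proof.
move=> [f f_iso fX].
have /choice[sigma sigmaE] : forall j, exists i, corner X' i = f (corner X j).
  move=> j; have : range (corner X') (f (corner X j)) by rewrite -fX; exists (corner X j).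
  by move=> [i _ <-]; exists i.
have /choice[tau tauE] : forall j, exists i, f (corner X i) = corner X' j.
  move=> j; have : (f @` range (corner X)) (corner X' j) by rewrite fX; exists j.
  by move=> [_ [i _ <-] <-]; exists i.
pose V j := vertex (intmx X') j.
pose Y : 'M[int]_3 := \matrix_i (V (sigma (lift ord0 i)) - V (sigma ord0)).
have map_inj : injective (map_mx intr : 'rV[int]_3 -> 'rV[R]_3).
  by move=> x y /rowP e; apply/rowP => i; have := e i; rewrite !mxE => /intr_inj.
have YE j : vertex Y j = V (sigma j) - V (sigma ord0).
  by rewrite /vertex; case: unliftP => [i|] -> /=; rewrite ?rowK ?subrr.
have YR j : map_mx intr (vertex Y j) = f (corner X j) - f (corner X ord0).
  by rewrite YE map_mxB /= -!sigmaE.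
exists (finfun tau), Y; split; last first.
  move=> j; apply: map_inj; rewrite !ffunE map_mxB /= !YR !tauE.
  rewrite -[LHS]subr0 opprB addrA subrK; congr (_ - _).
  by rewrite corner0.
apply/matrixP => i j; apply/eqP; rewrite -(eqr_int R); apply/eqP.
have gram (M : 'M[int]_3) : ((M *m M^T) i j)%:~R =
    dot (map_mx intr (vertex M (lift ord0 i))) (map_mx intr (vertex M (lift ord0 j))).
  rewrite /vertex !liftK /= /dot !mxE rmorph_sum; apply: eq_bigr => k _.
  by rewrite !mxE rmorphM.
by rewrite !gram !YR dot_edist !f_iso -dot_edist corner0 !subr0.
Qed.

End Geometry.

Lemma congruent_refl (R : realType) (S : set 'rV[R]_3) : congruent S S.
Proof. by exists id => //; rewrite image_id. Qed.

(** * The lower bound *)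

(** With [m = Q %/ 4] the family of diagonally dominant matrices has
    [(m + 1) ^ 9] members, and [4 * Q + 1 <= 16 * (m + 1)]. *)
Lemma T3_lower_bound (R : realType) (q : R) : 1 < q ->
  (Num.truncn q %/ 4).+1%N%:R ^+ 9 <=
  (#|` fset_set (T3 q)|%fset)%:R * (512 * 28 ^+ 2 * (64 * 16 ^+ 9) : R).
Proof.
move=> q1; set a : R := (_ %/ 4).+1%:R; have q0 : 0 <= q by lra.
set Q := Num.truncn q in a *; set m := (Q %/ 4)%N in a *.
have Q0 : (0 < Q)%N by rewrite truncn_ge_nat // ltW.
have mQ : (4 * m <= Q)%N by rewrite mulnC leq_divM.
have m_le : (m <= Q)%N by lia.
have Q_lt : (Q < 4 * m.+1)%N by rewrite mulnC -ltn_divLR.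
pose X (Z : 'M['I_m.+1]_3) := dominant Q Z.
have X_det Z : \det (intmx (X Z)) != 0 by exact: det_dominant_neq0.
have tetX Z := tetrahedra_corner q0 (X_det Z).
have cl_in Z : congruence_class q (range (corner (X Z))) \in fset_set (T3 q).
  by rewrite in_fset_set ?inE; [exists (range (corner (X Z)))|exact: finite_T3].
pose cl Z : fset_set (T3 q) := FSetSub (cl_in Z).
have isom Z Z' : cl Z == cl Z' ->
    exists (tau : {ffun 'I_4 -> 'I_4}) (Y : 'M[int]_3),
     Y *m Y^T = intmx (X Z) *m (intmx (X Z))^T /\
     forall j, vertex (intmx (X Z')) j = vertex Y (tau j) - vertex Y (tau ord0).
  move=> /eqP/(congr1 val) /= clZ; apply: isometric_corners.
  suff [] : congruence_class q (range (corner (X Z))) (range (corner (X Z'))) by [].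
  by rewrite clZ; split; [exact: tetX|exact: congruent_refl].
have pairs := card_isometric_pairs R (dominant_inj m_le) X_det isom.
have : 0 <= 512 * 28 ^+ 2 :> R.
  by apply: mulr_ge0; [exact: ler0n|exact/exprn_ge0/ler0n].
move: (512 * 28 ^+ 2 : R) pairs => K pairs K0.
have := sqr_card_le_fiber_pairs cl; rewrite card_mx card_ord -cardfE.
rewrite -(ler_nat R) natrM !natrX -/a => CS.
have a1 : 1 <= a by rewrite ler1n.
have max_le : (maxnorm Q)%:R ^+ 3 <= 64 * 16 ^+ 9 * a ^+ 9.
  have -> : 64 * 16 ^+ 9 * a ^+ 9 = (4 * (16 * a) ^+ 3) ^+ 3 by ring.
  have a_ge0 : 0 <= 16 * a by lra.
  have side_le : (4 * Q).+1%:R <= 16 * a.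
    by rewrite /a -natrM ler_nat; lia.
  apply: lerXn2r; rewrite ?nnegrE //; first by rewrite mulr_ge0 // exprn_ge0.
  by rewrite /maxnorm natrM natrX ler_pM2l // lerXn2r ?nnegrE.
have {}CS : (a ^+ 9) ^+ 2 <=
    (#|` fset_set (T3 q)|%fset)%:R * (K * (64 * 16 ^+ 9 * a ^+ 9)).
  apply: le_trans CS _; apply: ler_wpM2l => //; apply: le_trans pairs _.
  by rewrite ler_wpM2l.
have a9 : 0 < a ^+ 9 by rewrite exprn_gt0 //; lra.
rewrite -(ler_pM2r a9) -expr2; apply: le_trans CS _.
by rewrite -!mulrA.
Qed.

Theorem theorem1p2 (R : realType) (eps : R) (eps_gt0 : 0 < eps) :
  exists2 c : R, 0 < c &
    forall q : R, 1 < q ->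
      c * q `^ (9 - eps) <= (#|` fset_set (T3 q)|%fset)%:R.
Proof.
pose K : R := 512 * 28 ^+ 2 * (64 * 16 ^+ 9).
have pow0 n k : 0 < n.+1%:R ^+ k :> R by rewrite exprn_gt0.
have K0 : 0 < K.
  by rewrite /K; do 2 apply: mulr_gt0; rewrite ?ltr0n //; exact: pow0.
exists (4 ^+ 9 * K)^-1; first by rewrite invr_gt0 mulr_gt0 ?exprn_gt0.
move=> q q1; have := T3_lower_bound q1; rewrite -/K.
clearbody K; set N := (X in X * K); set a : R := (_ %/ 4).+1%:R => aN /=.
have q_le : q <= 4 * a.
  have := truncnS_gt q; rewrite /a -natrM => /ltW/le_trans; apply.
  by rewrite ler_nat mulnC -ltn_divLR.
rewrite ler_pdivrMl ?mulr_gt0 ?exprn_gt0 //.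
apply: (@le_trans _ _ (q ^+ 9)).
  rewrite -powR_mulrn; last by lra.
  by apply: ler_powR; lra.
apply: (@le_trans _ _ ((4 * a) ^+ 9)).
  by rewrite lerXn2r ?nnegrE //; lra.
rewrite exprMn -[leRHS]mulrA; apply: ler_wpM2l; first exact: exprn_ge0.
by rewrite mulrC.
Qed.
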